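(* Let $M\in\mathbb{C}^{n\times n}$ satisfy $\mathrm{Ind}(M)\le 1$, let $r=\mathrm{rk}(M)$, and let $b\in\mathbb{C}^n$. Let $L\in\mathbb{C}^{n\times(n-r)}$ with $\mathrm{rk}(L)=n-r$ and $\mathcal{R}(L)=\mathcal{N}(M^\ast)$. Then the problem $$\|Mx-b\|_F=\min\quad\text{subject to}\quad x\in\mathcal{R}(M)$$ has the unique solution $x=(x_1,x_2,\ldots,x_n)^T$ satisfying $$x_j=\frac{\det\left(\left(MM^\ast M+LL^\ast\right)(j\to MM^\ast b)\right)}{\det\left(MM^\ast M+LL^\ast\right)},\qquad j=1,2,\ldots,n$$ (in particular, the determinant in the denominator is nonzero).
   Context: $\mathcal{R}(\cdot)$ and $\mathcal{N}(\cdot)$ denote range (column space) and null space, $^\ast$ the conjugate transpose, and $\|\cdot\|_F$ the Frobenius norm (for a vector, the Euclidean norm). For a matrix $A$ and a column vector $c$ of matching length, $A(j\to c)$ denotes the matrix obtained from $A$ by replacing its $j$-th column by $c$. The index $\mathrm{Ind}(M)$ of a singular $M\in\mathbb{C}^{n\times n}$ is the smallest positive integer $k$ with $\mathrm{rk}(M^{k+1})=\mathrm{rk}(M^k)$; the index of a nonsingular matrix is $0$. A solution of the problem is a vector $x\in\mathcal{R}(M)$ minimizing $\|Mz-b\|_F$ over all $z\in\mathcal{R}(M)$. *)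

(* Defs.v *)
From HB Require Import structures.
From mathcomp Require Import all_boot all_order all_algebra.
From mathcomp Require Export spectral.
From mathcomp Require Export complex.
From mathcomp Require Import mathcomp_extra boolp classical_sets reals.
Set Implicit Arguments.
Unset Strict Implicit.
Unset Printing Implicit Defensive.
Import Order.TTheory GRing.Theory Num.Theory.
Local Open Scope classical_set_scope.
Local Open Scope ring_scope.
Local Open Scope sesquilinear_scope.

(* MathComp's matrix spaces (_ <= _)%MS are row spaces acting on the left;
   these are the column spaces and right null spaces of the text. *)
Definition colrange (F : pzRingType) m n (A : 'M[F]_(m, n)) : set 'cV[F]_m :=
  range (fun z : 'cV[F]_n => A *m z).

Definition nullspace (F : pzRingType) m n (A : 'M[F]_(m, n)) : set 'cV[F]_n :=
  [set x | A *m x = 0].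

Definition replace_col (F : Type) m n (A : 'M[F]_(m, n)) (j : 'I_n)
    (c : 'cV[F]_m) : 'M[F]_(m, n) :=
  \matrix_(i, k) if k == j then c i 0 else A i k.

Lemma index_exists (F : fieldType) n (M : 'M[F]_n) :
  exists k, (0 < k)%N && (\rank (M ^+ k.+1) == \rank (M ^+ k)).
Proof.
apply: contrapT => noP.
have step k : (0 < k)%N -> (\rank (M ^+ k.+1) < \rank (M ^+ k))%N.
  move=> k0; rewrite ltn_neqAle; apply/andP; split.
    by apply/negP => eqk; apply: noP; exists k; rewrite k0.
  by rewrite exprS -mulmxE mxrankM_maxr.
have bnd k : (\rank (M ^+ k.+1) + k <= n)%N.
  elim: k => [|k IHk]; first by rewrite addn0 rank_leq_row.
  by rewrite addnS -addSn (leq_trans _ IHk)// leq_add2r step.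
by have := bnd n.+1; rewrite addnS ltnNge leq_addl.
Qed.

Definition mxindex (F : fieldType) n (M : 'M[F]_n) : nat :=
  if M \in unitmx then 0%N else ex_minn (index_exists M).

Definition frobenius (R : rcfType) m n (A : 'M[R[i]]_(m, n)) : R :=
  Num.sqrt (\sum_i \sum_j ComplexField.Normc.normc (A i j) ^+ 2).

Definition is_solution (R : rcfType) n (M : 'M[R[i]]_n) (b x : 'cV[R[i]]_n) :=
  colrange M x /\
  forall z, colrange M z -> frobenius (M *m x - b) <= frobenius (M *m z - b).

(* Main.v *)
Require Import Defs.
From mathcomp Require Import all_boot all_order all_algebra.
From mathcomp Require Import classical_sets reals.
Set Implicit Arguments.
Unset Strict Implicit.
Unset Printing Implicit Defensive.
Import Order.TTheory GRing.Theory Num.Theory.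
Local Open Scope ring_scope.
Local Open Scope sesquilinear_scope.

(** Let A^H be the conjugate transpose of A, R(A) its column space and N(A)
    its right null space, and let D = M M^H M + L L^H. Two cancellation
    principles carry the proof.
    A Gram factor can be removed: A^H A B = 0 forces A B = 0
    ([mulmx_gram_eq0]). And since the index of M is at most one, M and M^2
    have the same rank, so that R(M) and N(M) meet only in 0
    ([index_le1_mulmx_eq0]). The matrix L supplies the orthogonality:
    M^H L = 0, and counting dimensions, N(L^H) = R(M) ([kernel_of_complement]).

    Suppose that D x = M M^H c. Multiplying on the left by M^H kills the term
    with L, and removing Gram factors from what remains gives the normal
    equation M^H (M x - c) = 0; substituted back, it leaves L L^H x = 0, so
    L^H x = 0 and x lies in R(M) ([bordered_system]). With c = 0 this says
    that D x = 0 puts x in both N(M) and R(M), whence x = 0: D is invertible.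
    With c = b it says that x = D^-1 M M^H b lies in R(M) and satisfies the
    normal equation. By Pythagoras such an x is a minimizer, and any other
    minimizer x' in R(M) has M x' = M x, hence x' = x ([normal_eq_unique]).
    Cramer's rule gives the coordinates of x. *)

(** The entries of adj(D) are the cofactors of D, so the j-th entry of
    adj(D) c is the Laplace expansion along column j of D with that column
    replaced by c; and adj(D) D = det(D). *)
Lemma cramer (F : comPzRingType) n (D : 'M[F]_n) (x : 'cV[F]_n) j :
  \det (replace_col D j (D *m x)) = \det D * x j 0.
Proof.
have -> : \det D * x j 0 = (\adj D *m (D *m x)) j 0.
  by rewrite mulmxA mul_adj_mx mul_scalar_mx !mxE.
rewrite (expand_det_col _ j) mxE; apply: eq_bigr => k _.
rewrite mxE eqxx [\adj D j k]mxE mulrC /cofactor; congr (_ * \det _ * _).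
by apply/matrixP => s t; rewrite !mxE eq_sym (negPf (neq_lift _ _)).
Qed.

Section Gram.
Variable C : numClosedFieldType.

Lemma adjmx_mul m n p (A : 'M[C]_(m, n)) (B : 'M[C]_(n, p)) :
  (A *m B) ^t* = B ^t* *m A ^t*.
Proof. by rewrite trmx_mul map_mxM. Qed.

Lemma rank_adjmx m n (A : 'M[C]_(m, n)) : \rank (A ^t*) = \rank A.
Proof. by rewrite mxrank_map mxrank_tr. Qed.

Lemma mxtrace_gram m n (A : 'M[C]_(m, n)) :
  \tr (A ^t* *m A) = \sum_i \sum_j `|A i j| ^+ 2.
Proof.
rewrite exchange_big; apply: eq_bigr => j _; rewrite mxE.
by apply: eq_bigr => i _; rewrite !mxE normCK mulrC.
Qed.

Lemma mxtrace_gram_eq0 m n (A : 'M[C]_(m, n)) : \tr (A ^t* *m A) = 0 -> A = 0.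
Proof.
rewrite mxtrace_gram => /psumr_eq0P A0; apply/matrixP => i j; rewrite mxE.
have /psumr_eq0P Ai0 : \sum_j `|A i j| ^+ 2 = 0.
  by apply: A0 => // k _; apply: sumr_ge0 => l _; rewrite exprn_ge0.
apply/eqP; rewrite -normr_eq0 -sqrf_eq0; apply/eqP.
by apply: Ai0 => // k _; rewrite exprn_ge0.
Qed.

(** The Gram matrix of A B is B^H (A^H A B), and its trace is the sum of the
    squared moduli of the entries of A B. *)
Lemma mulmx_gram_eq0 m n p (A : 'M[C]_(m, n)) (B : 'M[C]_(n, p)) :
  A ^t* *m (A *m B) = 0 -> A *m B = 0.
Proof.
move=> AAB0; apply: mxtrace_gram_eq0.
by rewrite adjmx_mul -mulmxA AAB0 mulmx0 mxtrace0.
Qed.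

Lemma mxtrace_gramD m n (A B : 'M[C]_(m, n)) : A ^t* *m B = 0 ->
  \tr ((A + B) ^t* *m (A + B)) = \tr (A ^t* *m A) + \tr (B ^t* *m B).
Proof.
move=> AB0; have BA0 : B ^t* *m A = 0.
  by rewrite -[A]trmxCK -adjmx_mul AB0 trmx0 map_mx0.
rewrite [(A + B)^T]linearD map_mxD mulmxDl !mulmxDr AB0 BA0 addr0 add0r.
by rewrite linearD.
Qed.

(** M^H L = 0 puts R(M) inside N(L^H), and both have dimension rk M. *)
Lemma kernel_of_complement n k p (M : 'M[C]_n) (L : 'M[C]_(n, k))
    (B : 'M[C]_(n, p)) :
  M ^t* *m L = 0 -> \rank L = (n - \rank M)%N -> L ^t* *m B = 0 ->
  exists Y, B = M *m Y.
Proof.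
move=> ML0 rkL LB0.
have sMk : (M ^t* <= kermx L)%MS by apply/sub_kermxP.
have skM : (kermx L <= M ^t*)%MS.
  have [_ <-] := mxrank_leqif_sup sMk.
  by rewrite mxrank_ker rkL rank_adjmx subKn // rank_leq_row.
have sBk : (B ^t* <= kermx L)%MS.
  by apply/sub_kermxP; rewrite -[L]trmxCK -adjmx_mul LB0 trmx0 map_mx0.
have /submxP[Y BY] := submx_trans sBk skM.
by exists (Y ^t*); rewrite -[B]trmxCK BY adjmx_mul trmxCK.
Qed.

(** The columns of x are treated together, so that the same lemma serves for
    the invertibility of D, applied to a matrix whose columns span N(D), and
    for the one system to be solved. *)
Lemma bordered_system n k p (M : 'M[C]_n) (L : 'M[C]_(n, k))
    (x c : 'M[C]_(n, p)) :
  M ^t* *m L = 0 -> \rank L = (n - \rank M)%N ->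
  (M *m M ^t* *m M + L *m L ^t*) *m x = M *m M ^t* *m c ->
  M ^t* *m (M *m x - c) = 0 /\ exists y, x = M *m y.
Proof.
move=> ML0 rkL Dx.
have MHMw : M ^t* *m (M *m (M ^t* *m (M *m x - c))) = 0.
  rewrite !mulmxBr !mulmxA.
  move: Dx => /(congr1 (mulmx (M ^t*))).
  rewrite mulmxDl mulmxDr !mulmxA ML0 !mul0mx addr0 => ->.
  by rewrite subrr.
have normal : M ^t* *m (M *m x - c) = 0.
  (* two Gram factors are removed, of M and then of M^H *)
  by apply: mulmx_gram_eq0; rewrite trmxCK; apply: mulmx_gram_eq0.
split=> //; apply: (kernel_of_complement ML0 rkL).
apply: mulmx_gram_eq0; rewrite trmxCK.
move: Dx; rewrite mulmxDl -!mulmxA => Dx.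
move/eqP: normal; rewrite mulmxBr subr_eq0 => /eqP normal.
by apply: (addrI (M *m (M ^t* *m (M *m x)))); rewrite Dx normal addr0.
Qed.

End Gram.

(** Equality of rk M^2 and rk M makes the rows of M combinations of the rows
    of M^2: M = X M^2 for some X. *)
Lemma index_le1_mulmx_eq0 (F : fieldType) n p (M : 'M[F]_n) (B : 'M[F]_(n, p)) :
  (mxindex M <= 1)%N -> M *m (M *m B) = 0 -> M *m B = 0.
Proof.
rewrite /mxindex; case: ifP => [uM _ MMB0|_].
  by rewrite -[M *m B](mulKmx uM) MMB0 mulmx0.
case: ex_minnP => k /andP[k_gt0 rkM] _ k_le1 MMB0.
have k1 : k = 1%N by apply/eqP; rewrite eqn_leq k_le1.
have rkMM : \rank (M *m M) == \rank M by move: rkM; rewrite k1 expr2 expr1.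
have [_ eqM] := mxrank_leqif_sup (submxMl M M).
move: rkMM; rewrite eqM => /submxP[X MX].
by rewrite MX -!mulmxA MMB0 mulmx0.
Qed.

Section LeastSquares.
Variable R : realType.

Lemma frobenius_ge0 m n (A : 'M[R[i]]_(m, n)) : 0 <= frobenius A.
Proof. exact: sqrtr_ge0. Qed.

Lemma frobenius_sqr m n (A : 'M[R[i]]_(m, n)) :
  ((frobenius A ^+ 2)%:C)%C = \tr (A ^t* *m A).
Proof.
rewrite mxtrace_gram sqr_sqrtr; last first.
  by apply: sumr_ge0 => i _; apply: sumr_ge0 => j _; rewrite sqr_ge0.
rewrite rmorph_sum; apply: eq_bigr => i _.
by rewrite rmorph_sum; apply: eq_bigr => j _; rewrite rmorphXn.
Qed.

Lemma frobenius_pythagoras m n (A B : 'M[R[i]]_(m, n)) : A ^t* *m B = 0 ->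
  frobenius (A + B) ^+ 2 = frobenius A ^+ 2 + frobenius B ^+ 2.
Proof.
move=> AB0; apply: (@complexI R).
by rewrite rmorphD /= !frobenius_sqr mxtrace_gramD.
Qed.

Lemma frobenius_eq0 m n (A : 'M[R[i]]_(m, n)) : frobenius A = 0 -> A = 0.
Proof.
by move=> A0; apply: mxtrace_gram_eq0; rewrite -frobenius_sqr A0 expr0n.
Qed.

(** The residual of x is orthogonal to R(M), so the residual of z is the
    hypotenuse over it with other leg M (z - x). *)
Lemma normal_eq_pythagoras n (M : 'M[R[i]]_n) (b x z : 'cV[R[i]]_n) :
  M ^t* *m (M *m x - b) = 0 ->
  frobenius (M *m z - b) ^+ 2 =
  frobenius (M *m (z - x)) ^+ 2 + frobenius (M *m x - b) ^+ 2.
Proof.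
move=> normal; rewrite -frobenius_pythagoras; last first.
  by rewrite adjmx_mul -mulmxA normal mulmx0.
by rewrite mulmxBr addrA subrK.
Qed.

Lemma normal_eq_unique n (M : 'M[R[i]]_n) (b x : 'cV[R[i]]_n) :
  (mxindex M <= 1)%N -> colrange M x -> M ^t* *m (M *m x - b) = 0 ->
  unique (is_solution M b) x.
Proof.
move=> hind Mx normal; split.
  split=> // z _; rewrite -ler_sqr ?nnegrE ?frobenius_ge0 //.
  by rewrite (normal_eq_pythagoras z normal) lerDr sqr_ge0.
move=> z [[w _ zE] /(_ x Mx)].
rewrite -ler_sqr ?nnegrE ?frobenius_ge0 // (normal_eq_pythagoras z normal).
rewrite gerDr => le0.
have /frobenius_eq0 Mzx0 : frobenius (M *m (z - x)) = 0.
  by apply/eqP; rewrite -sqrf_eq0 eq_le le0 sqr_ge0.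
case: Mx Mzx0 => y _ <-; rewrite -zE -mulmxBr => /(index_le1_mulmx_eq0 hind).
by move/eqP; rewrite mulmxBr subr_eq0 => /eqP ->.
Qed.

End LeastSquares.

Lemma colrange_sub_nullspace (F : pzRingType) m n p (A : 'M[F]_(m, n))
    (B : 'M[F]_(n, p)) :
  (colrange B `<=` nullspace A)%classic -> A *m B = 0.
Proof.
move=> sBA; apply/matrixP => i j; have /sBA : colrange B (col j B).
  by exists (delta_mx j 0); rewrite // -colE.
by rewrite /nullspace /= colE mulmxA -colE => /colP/(_ i); rewrite !mxE.
Qed.

Theorem theorem3p6 (R : realType) (n r : nat) (M : 'M[R[i]]_n)
    (b : 'cV[R[i]]_n) (L : 'M[R[i]]_(n, n - r))
    (hind : (mxindex M <= 1)%N) (hr : r = \rank M)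
    (hL : \rank L = (n - r)%N) (hLM : colrange L = nullspace (M ^t*)) :
  let D := M *m M ^t* *m M + L *m L ^t* in
  \det D != 0 /\
  exists x : 'cV[R[i]]_n,
    unique (is_solution M b) x /\
    forall j : 'I_n,
      x j 0 = \det (replace_col D j (M *m M ^t* *m b)) / \det D.
Proof.
move=> D.
have ML0 : M ^t* *m L = 0 by apply: colrange_sub_nullspace; rewrite hLM.
have rkL : \rank L = (n - \rank M)%N by rewrite hL hr.
have Dinj (B : 'M_n) : D *m B = 0 -> B = 0.
  move=> DB0; have [|MMB0 [Y BY]] := bordered_system (x := B) (c := 0) ML0 rkL.
    by rewrite DB0 mulmx0.
  rewrite BY; apply: (index_le1_mulmx_eq0 hind); rewrite -BY.
  by apply: mulmx_gram_eq0; rewrite -MMB0 subr0.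
have uD : D \in unitmx.
  rewrite -row_full_unit -cokermx_eq0; apply/eqP.
  by apply: Dinj; rewrite mulmx_coker.
have detD : \det D != 0 by move: uD; rewrite unitmxE unitfE.
split=> //; pose x := invmx D *m (M *m M ^t* *m b).
have Dx : D *m x = M *m M ^t* *m b by rewrite mulKVmx.
have [normal [y xE]] := bordered_system ML0 rkL Dx.
exists x; split; first by apply: normal_eq_unique => //; exists y.
by move=> j; rewrite -Dx cramer mulrC mulKf.
Qed.
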